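(* Let $(\mathcal A,\mu,\alpha_1,\beta_1)$ be a 3-totally Bihom-associative superalgebra and $(\mathfrak g,[\cdot,\cdot,\cdot],\alpha_2,\beta_2)$ a 3-Bihom-Lie superalgebra over a field $\mathbb K$. Suppose that $\alpha_1$ is surjective and that for all $a_1,a_2,a_3\in\mathcal A$ $$\mu(\beta_1(a_1),\beta_1(a_2),\alpha_1(a_3))=\mu(\beta_1(a_2),\beta_1(a_1),\alpha_1(a_3))=\mu(\beta_1(a_1),\beta_1(a_3),\alpha_1(a_2)).$$ Then $(\mathcal A\otimes\mathfrak g,[\cdot,\cdot,\cdot]_{\mathcal A\otimes\mathfrak g},\alpha,\beta)$ is a 3-Bihom-Lie superalgebra, where the trilinear map $[\cdot,\cdot,\cdot]_{\mathcal A\otimes\mathfrak g}$ on $\mathcal A\otimes\mathfrak g$ is given by $$[a_1\otimes x_1,a_2\otimes x_2,a_3\otimes x_3]_{\mathcal A\otimes\mathfrak g}=\mu(a_1,a_2,a_3)\otimes[x_1,x_2,x_3],\qquad a_i\in\mathcal A,\ x_i\in\mathfrak g,\ i=1,2,3,$$ and the two linear maps $\alpha,\beta:\mathcal A\otimes\mathfrak g\to\mathcal A\otimes\mathfrak g$ are given by $\alpha(a\otimes x)=\alpha_1(a)\otimes\alpha_2(x)$ and $\beta(a\otimes x)=\beta_1(a)\otimes\beta_2(x)$.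
   Context: A 3-totally Bihom-associative superalgebra is a quadruple $(\mathcal A,\mu,\alpha,\beta)$ consisting of a ($\mathbb Z_2$-graded) linear space $\mathcal A$, an even trilinear map $\mu:\mathcal A\otimes\mathcal A\otimes\mathcal A\to\mathcal A$ and two even linear maps $\alpha,\beta:\mathcal A\to\mathcal A$ such that for all $a_1,\dots,a_5\in\mathcal A$: $\alpha\circ\beta=\beta\circ\alpha$; $\alpha(\mu(a_1,a_2,a_3))=\mu(\alpha(a_1),\alpha(a_2),\alpha(a_3))$ and $\beta(\mu(a_1,a_2,a_3))=\mu(\beta(a_1),\beta(a_2),\beta(a_3))$; and $\mu(\mu(a_1,a_2,a_3),\beta(a_4),\beta(a_5))=\mu(\alpha(a_1),\mu(a_2,a_3,a_4),\beta(a_5))=\mu(\alpha(a_1),\alpha(a_2),\mu(a_3,a_4,a_5))$. $\mathcal A\otimes\mathfrak g$ is the tensor product of the $\mathbb Z_2$-graded spaces $\mathcal A$ and $\mathfrak g$. For a homogeneous element $x$, $|x|\in\mathbb Z_2$ denotes its degree; identities involving $|x|$ are for homogeneous elements. A 3-Bihom-Lie superalgebra over $\mathbb K$ is a quadruple $(\mathfrak g,[\cdot,\cdot,\cdot],\alpha,\beta)$ consisting of a $\mathbb Z_2$-graded vector space $\mathfrak g=\mathfrak g_0\oplus\mathfrak g_1$, an even trilinear map $[\cdot,\cdot,\cdot]:\mathfrak g\otimes\mathfrak g\otimes\mathfrak g\to\mathfrak g$ and two even endomorphisms $\alpha,\beta:\mathfrak g\to\mathfrak g$ such that for all $x,y,z,u,v\in\mathfrak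 g$: (1) $\alpha\circ\beta=\beta\circ\alpha$; (2) $\alpha([x,y,z])=[\alpha(x),\alpha(y),\alpha(z)]$ and $\beta([x,y,z])=[\beta(x),\beta(y),\beta(z)]$; (3) $[\beta(x),\beta(y),\alpha(z)]=-(-1)^{|x||y|}[\beta(y),\beta(x),\alpha(z)]=-(-1)^{|y||z|}[\beta(x),\beta(z),\alpha(y)]$; (4) $[\beta^2(x),\beta^2(y),[\beta(z),\beta(u),\alpha(v)]]=(-1)^{(|u|+|v|)(|x|+|y|+|z|)}[\beta^2(u),\beta^2(v),[\beta(x),\beta(y),\alpha(z)]]-(-1)^{(|z|+|v|)(|x|+|y|)+|u||v|}[\beta^2(z),\beta^2(v),[\beta(x),\beta(y),\alpha(u)]]+(-1)^{(|z|+|u|)(|x|+|y|)}[\beta^2(z),\beta^2(u),[\beta(x),\beta(y),\alpha(v)]]$.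
   Formalization: With total degree |a|+|x| the claim fails (A=Q[e]/(e²-1), e odd; g odd, [x,x,x]=y). Proved instead: for every A with a⊗x given degree |x| (A regarded as even), and for the usual total grading on A⊗g when A has zero odd part. *)

(* Defs.v *)
From HB Require Import structures.
From mathcomp Require Import all_boot all_order all_algebra.
Set Implicit Arguments.
Unset Strict Implicit.
Unset Printing Implicit Defensive.
Import GRing.Theory.
Local Open Scope ring_scope.

Section LinearAlgebra.
Variable K : fieldType.

Definition trilinear (V : lmodType K) (f : V -> V -> V -> V) : Prop :=
  [/\ forall y z, linear (fun x => f x y z),
      forall x z, linear (fun y => f x y z)
    & forall x y, linear (fun z => f x y z)].

(* The universal property, over an arbitrary carrier T: spaces may be
   infinite-dimensional. *)
Definition is_tensor_product (U V T : lmodType K)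
    (tens : {bilinear U -> V -> T}) : Prop :=
  forall (W : lmodType K) (f : {bilinear U -> V -> W}),
    (exists h : {linear T -> W}, forall u v, h (tens u v) = f u v) /\
    (forall h1 h2 : {linear T -> W},
      (forall u v, h1 (tens u v) = h2 (tens u v)) -> h1 =1 h2).

Inductive lspan (V : lmodType K) (S : V -> Prop) : V -> Prop :=
| lspan0 : lspan S 0
| lspan_step (c : K) (v w : V) : S v -> lspan S w -> lspan S (c *: v + w).

End LinearAlgebra.

Section Graded.
Variable K : fieldType.

(* G i v reads: v is homogeneous of degree i (so 0 has both degrees). *)
Record is_grading (V : lmodType K) (G : 'Z_2 -> V -> Prop) : Prop := {
  grading0 : forall i, G i 0;
  gradingP : forall i (c : K) v w, G i v -> G i w -> G i (c *: v + w);
  grading_sum : forall v, exists v0 v1, [/\ G 0 v0, G 1 v1 & v = v0 + v1];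
  grading_direct : forall v, G 0 v -> G 1 v -> v = 0
}.

Definition even_map (V : lmodType K) (G : 'Z_2 -> V -> Prop) (f : V -> V) :
    Prop :=
  forall i x, G i x -> G i (f x).

Definition even_map3 (V : lmodType K) (G : 'Z_2 -> V -> Prop)
    (f : V -> V -> V -> V) : Prop :=
  forall i j k x y z, G i x -> G j y -> G k z -> G (i + j + k) (f x y z).

(* With U in this grading, tensor_grading below gives u (x) v the degree of v
   alone. The sign rules of a superalgebra then involve only the degrees of V,
   which is what an unsigned product (a1 (x) x1, ...) |-> mu (x) [x1, x2, x3]
   with mu commuting without signs is compatible with. *)
Definition even_grading (V : lmodType K) (i : 'Z_2) (v : V) : Prop :=
  i = 0 \/ v = 0.

Definition tensor_grading (U V T : lmodType K) (tens : U -> V -> T)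
    (GU : 'Z_2 -> U -> Prop) (GV : 'Z_2 -> V -> Prop) (i : 'Z_2) : T -> Prop :=
  lspan (fun t => exists j k u v,
    [/\ GU j u, GV k v, j + k = i & t = tens u v]).

(* Well defined because the order of -1 divides 2: i is read through its
   representative 0 or 1. *)
Definition sgn2 (i : 'Z_2) : K := (-1) ^+ (i : nat).

Record is_3totally_bihom_assoc_superalgebra (A : lmodType K)
    (G : 'Z_2 -> A -> Prop) (mu : A -> A -> A -> A)
    (alpha beta : {linear A -> A}) : Prop := {
  tba_grading : is_grading G;
  tba_trilinear : trilinear mu;
  tba_even_mu : even_map3 G mu;
  tba_even_alpha : even_map G alpha;
  tba_even_beta : even_map G beta;
  tba_comm : forall a, alpha (beta a) = beta (alpha a);
  tba_alphaM : forall a b c,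
    alpha (mu a b c) = mu (alpha a) (alpha b) (alpha c);
  tba_betaM : forall a b c, beta (mu a b c) = mu (beta a) (beta b) (beta c);
  tba_assocl : forall a1 a2 a3 a4 a5,
    mu (mu a1 a2 a3) (beta a4) (beta a5) =
    mu (alpha a1) (mu a2 a3 a4) (beta a5);
  tba_assocr : forall a1 a2 a3 a4 a5,
    mu (alpha a1) (mu a2 a3 a4) (beta a5) =
    mu (alpha a1) (alpha a2) (mu a3 a4 a5)
}.

Record is_3bihom_Lie_superalgebra (V : lmodType K)
    (G : 'Z_2 -> V -> Prop) (br : V -> V -> V -> V)
    (alpha beta : {linear V -> V}) : Prop := {
  bls_grading : is_grading G;
  bls_trilinear : trilinear br;
  bls_even_br : even_map3 G br;
  bls_even_alpha : even_map G alpha;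
  bls_even_beta : even_map G beta;
  bls_comm : forall x, alpha (beta x) = beta (alpha x);
  bls_alphaM : forall x y z,
    alpha (br x y z) = br (alpha x) (alpha y) (alpha z);
  bls_betaM : forall x y z, beta (br x y z) = br (beta x) (beta y) (beta z);
  bls_skewl : forall (dx dy dz : 'Z_2) x y z,
    G dx x -> G dy y -> G dz z ->
    br (beta x) (beta y) (alpha z) =
    - (sgn2 (dx * dy) *: br (beta y) (beta x) (alpha z));
  bls_skewr : forall (dx dy dz : 'Z_2) x y z,
    G dx x -> G dy y -> G dz z ->
    br (beta x) (beta y) (alpha z) =
    - (sgn2 (dy * dz) *: br (beta x) (beta z) (alpha y));
  bls_jacobi : forall (dx dy dz du dv : 'Z_2) x y z u v,
    G dx x -> G dy y -> G dz z -> G du u -> G dv v ->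
    br (beta (beta x)) (beta (beta y)) (br (beta z) (beta u) (alpha v)) =
      sgn2 ((du + dv) * (dx + dy + dz)) *:
        br (beta (beta u)) (beta (beta v)) (br (beta x) (beta y) (alpha z))
    - sgn2 ((dz + dv) * (dx + dy) + du * dv) *:
        br (beta (beta z)) (beta (beta v)) (br (beta x) (beta y) (alpha u))
    + sgn2 ((dz + du) * (dx + dy)) *:
        br (beta (beta z)) (beta (beta u)) (br (beta x) (beta y) (alpha v))
}.

End Graded.

Arguments even_grading {K} V.

(* Main.v *)
(** Every homogeneous element of the tensor product is a combination of pure
    tensors [a (x) x] with [x] homogeneous, so each axiom reduces by
    multilinearity to pure tensors.  There it is the axiom of [g], provided the
    [A]-factors of all terms agree.  For the Jacobi identity that factor is
    [mu (beta^2 a1) (beta^2 a2) (mu (beta a3) (beta a4) (alpha a5))], which is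
    symmetric in all five arguments: writing [a1], [a2], [a3] as
    [alpha1 b1], [alpha1 b2], [alpha1 b3], total associativity turns it into
    [S (S b1 b2 b3) (beta a4) (beta a5)], where
    [S a b c = mu (beta a) (beta b) (alpha c)] is symmetric by hypothesis. *)
From HB Require Import structures.
Require Import Defs.
From mathcomp Require Import all_boot all_order all_algebra.
From mathcomp Require Import boolp functions.
Set Implicit Arguments.
Unset Strict Implicit.
Unset Printing Implicit Defensive.
Import GRing.Theory.
Local Open Scope ring_scope.

(** * Linear functions, spans and projections of a grading *)

Section Linear.
Variable K : fieldType.
Implicit Types U V W : lmodType K.

(** The universal property quantifies over bundled maps, while functions obtained from lifts or by
    choice are linear only as a proposition; this lemma and [bilinear_bundle] pass from the second
    form to the first. *)
Lemma linear_bundle V W (f : V -> W) :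
  linear f -> exists h : {linear V -> W}, h =1 f.
Proof.
move=> fP.
pose h : {linear V -> W} := HB.pack f (GRing.isLinear.Build K V W _ f fP).
by exists h.
Qed.

Lemma bilinear_bundle U V W (f : U -> V -> W) :
    (forall v, linear (f^~ v)) -> (forall u, linear (f u)) ->
  exists h : {bilinear U -> V -> W}, forall u v, h u v = f u v.
Proof.
move=> fl fr.
pose h : {bilinear U -> V -> W} := HB.pack f
  (bilinear_isBilinear.Build K U V W *:%R *:%R f (conj fl fr)).
by exists h.
Qed.

Lemma linear_fun_id V : linear (fun x : V => x).
Proof. by []. Qed.

Lemma linear_fun_comp U V W (h : {linear V -> W}) (f : U -> V) :
  linear f -> linear (fun x => h (f x)).
Proof. by move=> fP c u v; rewrite fP linearP. Qed.

Lemma linear_fun_add V W (f h : V -> W) :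
  linear f -> linear h -> linear (fun x => f x + h x).
Proof. by move=> fP hP c u v; rewrite fP hP scalerDr addrACA. Qed.

Lemma linear_fun_opp V W (f : V -> W) : linear f -> linear (fun x => - f x).
Proof. by move=> fP c u v; rewrite fP opprD scalerN. Qed.

Lemma linear_fun_scale V W (a : K) (f : V -> W) :
  linear f -> linear (fun x => a *: f x).
Proof. by move=> fP c u v; rewrite fP scalerDr !scalerA mulrC. Qed.

Lemma trilinear_fun1 U V (br : V -> V -> V -> V) (f : U -> V) y z :
  trilinear br -> linear f -> linear (fun x => br (f x) y z).
Proof. by case=> b1 _ _ fP c u v; rewrite fP b1. Qed.

Lemma trilinear_fun2 U V (br : V -> V -> V -> V) (f : U -> V) x z :
  trilinear br -> linear f -> linear (fun y => br x (f y) z).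
Proof. by case=> _ b2 _ fP c u v; rewrite fP b2. Qed.

Lemma trilinear_fun3 U V (br : V -> V -> V -> V) (f : U -> V) x y :
  trilinear br -> linear f -> linear (fun z => br x y (f z)).
Proof. by case=> _ _ b3 fP c u v; rewrite fP b3. Qed.

Lemma lspan_gen V (S : V -> Prop) v : S v -> lspan S v.
Proof.
by move=> Sv; rewrite -[v]addr0 -[v]scale1r; apply: lspan_step (lspan0 S).
Qed.

Lemma lspanP V (S : V -> Prop) (c : K) v w :
  lspan S v -> lspan S w -> lspan S (c *: v + w).
Proof.
move=> Sv; elim: Sv c w => [|d u v' Su _ IH] c w Sw; first by rewrite scaler0 add0r.
rewrite scalerDr scalerA -addrA; apply: lspan_step => //; exact: IH.
Qed.

Lemma lspan_map V W (S : V -> Prop) (S' : W -> Prop) (f : V -> W) :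
    linear f -> (forall v, S v -> lspan S' (f v)) ->
  forall v, lspan S v -> lspan S' (f v).
Proof.
move=> fP SS' v; elim=> [|c u w Su _ IH]; last by rewrite fP; apply: lspanP; auto.
have [h hf] := linear_bundle fP.
by rewrite -hf linear0; apply: lspan0.
Qed.

(** Reduces a graded identity to pure tensors, one argument at a time, since homogeneous elements of
    the tensor product form a span. *)
Lemma lspan_linear_eq V W (S : V -> Prop) (f h : V -> W) :
    linear f -> linear h -> (forall v, S v -> f v = h v) ->
  forall v, lspan S v -> f v = h v.
Proof.
move=> fP hP fh v; elim=> [|c u w Su _ IH]; last by rewrite fP hP fh ?IH.
have [[f' f'E] [h' h'E]] := (linear_bundle fP, linear_bundle hP).
by rewrite -f'E -h'E !linear0.
Qed.

Lemma Z2_cases (i : 'Z_2) : i = 0 \/ i = 1.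
Proof.
by case: i => [[|[|i]] lti] //; [left | right]; apply: val_inj.
Qed.

(** The degree 0 component is picked by choice; directness of the sum makes it unique, and
    uniqueness makes it linear. *)
Lemma grading_proj V (G : 'Z_2 -> V -> Prop) : is_grading G ->
  exists p : 'Z_2 -> V -> V, [/\ forall i, linear (p i),
    forall i v, G i (p i v), forall v, v = p 0 v + p 1 v &
    forall v i j, G i v -> p j v = if i == j then v else 0].
Proof.
move=> [G0 GP Gsum Gdir].
have GB i v w : G i v -> G i w -> G i (v - w).
  by move=> Gv Gw; rewrite addrC -scaleN1r; apply: GP.
have GD i v w : G i v -> G i w -> G i (v + w).
  by move=> Gv Gw; rewrite -[v]scale1r; apply: GP.
have [q qP] : {q : V -> V & forall v, G 0 (q v) /\ G 1 (v - q v)}.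
  apply: (choice (P := fun v w => G 0 w /\ G 1 (v - w))) => v.
  have [v0 [v1 [G0v G1v ->]]] := Gsum v.
  by exists v0; rewrite [v0 + _]addrC addrK.
have qU v w : G 0 w -> G 1 (v - w) -> q v = w.
  move=> G0w G1w; have [G0q G1q] := qP v; apply/subr0_eq/Gdir; first exact: GB.
  (* The difference already has degree 0; in this form it visibly has degree 1 as well, so it
     vanishes. *)
  rewrite (_ : q v - w = (v - w) - (v - q v)); first exact: GB.
  by rewrite opprB [RHS]addrC subrKA.
have qlin : linear q.
  move=> c u v; apply: qU; first by apply: GP; [case: (qP u) | case: (qP v)].
  rewrite opprD addrACA -scalerBr.
  by apply: GP; [case: (qP u) | case: (qP v)].
exists (fun i v => if i == 0 then q v else v - q v); split.
- move=> i; case: (i == 0) => // c u v; rewrite qlin.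
  by rewrite opprD addrACA -scalerBr.
- by move=> i v; case: (Z2_cases i) => -> /=; case: (qP v).
- by move=> v /=; rewrite addrC subrK.
- move=> v i j Gv; case: (Z2_cases i) Gv => -> Gv; case: (Z2_cases j) => -> /=.
  + by apply: qU; rewrite // subrr.
  + by rewrite (qU v v) ?subrr.
  + by apply: qU; rewrite // subr0.
  + by rewrite (qU v 0) ?subr0.
Qed.

End Linear.

(** * The span as a vector space *)

Section Span.
Variables (K : fieldType) (V : lmodType K) (S : V -> Prop).

(** Reflecting the span into a boolean predicate lets [lspan_sub] inherit a module structure, so
    that it can be the target of a lift. *)
Definition lspan_pred : {pred V} := fun v => `[< lspan S v >].

Lemma lspan_pred_submod : submod_closed lspan_pred.
Proof.
split=> [|c u v /asboolP Su /asboolP Sv]; first exact/asboolP/lspan0.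
exact/asboolP/lspanP.
Qed.

HB.instance Definition _ :=
  GRing.isSubmodClosed.Build K V lspan_pred lspan_pred_submod.

Record lspan_sub := LspanSub { lspan_val : V; _ : lspan_val \in lspan_pred }.

HB.instance Definition _ := [isSub for lspan_val].
HB.instance Definition _ := [Choice of lspan_sub by <:].
HB.instance Definition _ := [SubChoice_isSubLmodule of lspan_sub by <:].

End Span.

(** * Maps out of the tensor product *)

Section Tensor.
Variables (K : fieldType) (U V T : lmodType K).
Variables (tens : {bilinear U -> V -> T}) (tensP : is_tensor_product tens).

Lemma tensor_ext (W : lmodType K) (f h : T -> W) : linear f -> linear h ->
  (forall u v, f (tens u v) = h (tens u v)) -> forall t, f t = h t.
Proof.
(* The uniqueness clause is stated under a bilinear map that it does not mention; the zero map
   serves. *)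
move=> fP hP fh t; have [||z _] := @bilinear_bundle K U V W (fun _ _ => 0).
- by move=> v c u u'; rewrite scaler0 addr0.
- by move=> u c v v'; rewrite scaler0 addr0.
have [_ uniq] := tensP z.
have [[f' f'E] [h' h'E]] := (linear_bundle fP, linear_bundle hP).
by rewrite -f'E -h'E; apply: uniq => u v; rewrite f'E h'E.
Qed.

Lemma tensor_lift (W : lmodType K) (f : U -> V -> W) :
    (forall v, linear (f^~ v)) -> (forall u, linear (f u)) ->
  exists h : {linear T -> W}, forall u v, h (tens u v) = f u v.
Proof.
move=> fl fr; have [f' f'E] := bilinear_bundle fl fr.
have [[h hE] _] := tensP f'.
by exists h => u v; rewrite hE f'E.
Qed.

(* Lifting into the function space [I -> W] treats all parameters at once, so no
   choice of a lift for each parameter is made. *)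
Lemma tensor_lift_family (I : Type) (W : lmodType K) (f : I -> U -> V -> W) :
    (forall i v, linear ((f i)^~ v)) -> (forall i u, linear (f i u)) ->
  exists h : I -> T -> W, (forall i, linear (h i)) /\
    forall i u v, h i (tens u v) = f i u v.
Proof.
move=> fl fr.
have [||h hE] := @tensor_lift (I -> W)%type (fun u v i => f i u v).
- by move=> v c u u'; apply: funext => i; apply: fl.
- by move=> u c v v'; apply: funext => i; apply: fr.
exists (fun i t => h t i); split=> [i c t t'|i u v]; last by rewrite hE.
by rewrite linearP.
Qed.

(* Corestricting [tens] to the span of its image and lifting gives a section of
   the inclusion of that span in [T]. *)
Lemma tensor_span t : lspan (fun t => exists u v, t = tens u v) t.
Proof.
set S := fun t => _.
have Stens u v : tens u v \in lspan_pred S.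
  by apply/asboolP/lspan_gen; exists u, v.
have [||h hE] := @tensor_lift (lspan_sub S) (fun u v => LspanSub (Stens u v)).
- by move=> v c u u'; apply: val_inj; rewrite [RHS]linearP /= linearPl.
- by move=> u c v v'; apply: val_inj; rewrite [RHS]linearP /= linearPr.
have <- : val (h t) = t.
  apply: (@tensor_ext T (fun t => val (h t)) id) => //.
  - by move=> c u v; rewrite !linearP.
  - by move=> u v; rewrite hE.
by apply/asboolP; case: (h t).
Qed.

End Tensor.

(** * Symmetry of the iterated product *)

(** The three permutations are those of the three terms on the right of the Jacobi identity, in
    order. *)
Lemma mu_perm (K : fieldType) (A : lmodType K) (GA : 'Z_2 -> A -> Prop)
    (mu : A -> A -> A -> A) (alpha beta : {linear A -> A}) :
    is_3totally_bihom_assoc_superalgebra GA mu alpha beta ->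
    (forall b, exists a, alpha a = b) ->
    (forall a1 a2 a3,
       mu (beta a1) (beta a2) (alpha a3) = mu (beta a2) (beta a1) (alpha a3) /\
       mu (beta a2) (beta a1) (alpha a3) = mu (beta a1) (beta a3) (alpha a2)) ->
  let P a1 a2 a3 a4 a5 := mu (beta (beta a1)) (beta (beta a2))
    (mu (beta a3) (beta a4) (alpha a5)) in
  forall a1 a2 a3 a4 a5, [/\ P a1 a2 a3 a4 a5 = P a4 a5 a1 a2 a3,
    P a1 a2 a3 a4 a5 = P a3 a5 a1 a2 a4 &
    P a1 a2 a3 a4 a5 = P a3 a4 a1 a2 a5].
Proof.
move=> hA surj mu_comm P.
pose S a b c := mu (beta a) (beta b) (alpha c).
have S12 a b c : S a b c = S b a c by have [] := mu_comm a b c.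
have S23 a b c : S a b c = S a c b by have [h1 h2] := mu_comm a b c; rewrite /S h1.
have PS b1 b2 b3 a4 a5 : P (alpha b1) (alpha b2) (alpha b3) a4 a5 =
    S (S b1 b2 b3) (beta a4) (beta a5).
  rewrite /P /S -!(tba_comm hA) -(tba_assocr hA) -(tba_assocl hA).
  by rewrite (tba_betaM hA) !(tba_comm hA).
(* Adjacent transpositions: [p12] and [p23] act inside [S b1 b2 b3], [p34] and [p45] inside the
   inner [mu]. *)
have p12 a1 a2 a3 a4 a5 : P a1 a2 a3 a4 a5 = P a2 a1 a3 a4 a5.
  have [[b1 <-] [b2 <-] [b3 <-]] := And3 (surj a1) (surj a2) (surj a3).
  by rewrite !PS (S12 b1).
have p23 a1 a2 a3 a4 a5 : P a1 a2 a3 a4 a5 = P a1 a3 a2 a4 a5.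
  have [[b1 <-] [b2 <-] [b3 <-]] := And3 (surj a1) (surj a2) (surj a3).
  by rewrite !PS (S23 b1).
have p34 a1 a2 a3 a4 a5 : P a1 a2 a3 a4 a5 = P a1 a2 a4 a3 a5.
  by congr mu; apply: S12.
have p45 a1 a2 a3 a4 a5 : P a1 a2 a3 a4 a5 = P a1 a2 a3 a5 a4.
  by congr mu; apply: S23.
(* Exchange of the first two pairs; the other two permutations first reorder the last three
   arguments. *)
have P4 a1 a2 a3 a4 a5 : P a1 a2 a3 a4 a5 = P a3 a4 a1 a2 a5.
  by rewrite p23 p12 p34 p23.
move=> a1 a2 a3 a4 a5; split; last exact: P4.
- by rewrite p34 p45 P4.
- by rewrite p45 P4.
Qed.

(** Peels off the operations around the variable; [solve] forces backtracking, so the slot of a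
    trilinear map holding the variable is found by trial. *)
Ltac prove_linear := first
  [ exact: linear_fun_id
  | solve [apply: linear_fun_add; prove_linear]
  | solve [apply: linear_fun_opp; prove_linear]
  | solve [apply: linear_fun_scale; prove_linear]
  | solve [apply: trilinear_fun1; [by [] | prove_linear]]
  | solve [apply: trilinear_fun2; [by [] | prove_linear]]
  | solve [apply: trilinear_fun3; [by [] | prove_linear]]
  | solve [apply: linear_fun_comp; prove_linear] ].

(** * Construction of the twisting maps and the bracket *)

Section TensorTrilinear.
Variables (K : fieldType) (A g T : lmodType K).
Variables (tens : {bilinear A -> g -> T}) (tensP : is_tensor_product tens).

Lemma tensor_linear_map (p : {linear A -> A}) (q : {linear g -> g}) :
  exists h : {linear T -> T}, forall a x, h (tens a x) = tens (p a) (q x).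
Proof.
apply: (tensor_lift tensP (f := fun a x => tens (p a) (q x))).
- by move=> x c a a'; rewrite linearP linearPl.
- by move=> a c x x'; rewrite linearP linearPr.
Qed.

(** The arguments are lifted one at a time, the others being parameters: [f] lifts the first, [h]
    the second, [m] the third. A lift is linear in its own argument only; linearity in the earlier
    ones is checked on pure tensors. *)
Lemma tensor_trilinear_map (mu : A -> A -> A -> A) (brg : g -> g -> g -> g) :
    trilinear mu -> trilinear brg ->
  exists2 br : T -> T -> T -> T, trilinear br &
    forall a1 a2 a3 x1 x2 x3, br (tens a1 x1) (tens a2 x2) (tens a3 x3) =
      tens (mu a1 a2 a3) (brg x1 x2 x3).
Proof.
move=> [mu1 mu2 mu3] [br1 br2 br3].
(* Linearity in a parameter equates a lift with such a combination of lifts; [tensor_ext] needs the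
   combination to be linear too. *)
have comb (I : Type) (f : I -> T -> T) k i j : (forall i, linear (f i)) ->
  linear (fun t => k *: f i t + f j t).
  by move=> f_lin; apply/linear_fun_add/f_lin/linear_fun_scale/f_lin.
have [||f [f_lin fE]] := tensor_lift_family tensP
    (f := fun (i : A * g * A * g) a x =>
      let: (b, y, c, z) := i in tens (mu a b c) (brg x y z)).
- by move=> [[[b y] c] z] x k a a'; rewrite mu1 linearPl.
- by move=> [[[b y] c] z] a k x x'; rewrite br1 linearPr.
have [||h [h_lin hE]] := tensor_lift_family tensP
    (f := fun (i : T * A * g) b y => let: (t, c, z) := i in f (b, y, c, z) t).
- move=> [[t c] z] y k b b'; move: t.
  apply: (tensor_ext tensP (f_lin _) (comb _ _ _ _ _ f_lin)) => a x.
  by rewrite !fE mu2 linearPl.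
- move=> [[t c] z] b k y y'; move: t.
  apply: (tensor_ext tensP (f_lin _) (comb _ _ _ _ _ f_lin)) => a x.
  by rewrite !fE br2 linearPr.
have h_linl c z u : linear (fun t => h (t, c, z) u).
  move=> k t t'; move: u.
  apply: (tensor_ext tensP (h_lin _) (comb _ _ _ _ _ h_lin)) => b y.
  by rewrite !hE f_lin.
have h_comb k c c' z z' u :
    linear (fun t => k *: h (t, c, z) u + h (t, c', z') u).
  by apply/linear_fun_add/h_linl/linear_fun_scale/h_linl.
have [||m [m_lin mE]] := tensor_lift_family tensP
    (f := fun (i : T * T) c z => h (i.1, c, z) i.2).
- move=> [t u] z k c c' /=; move: u.
  apply: (tensor_ext tensP (h_lin _) (comb _ _ _ _ _ h_lin)) => b y; move: t.
  apply: (tensor_ext tensP (h_linl _ _ _) (h_comb _ _ _ _ _ _)) => a x.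
  by rewrite !hE !fE mu3 linearPl.
- move=> [t u] c k z z' /=; move: u.
  apply: (tensor_ext tensP (h_lin _) (comb _ _ _ _ _ h_lin)) => b y; move: t.
  apply: (tensor_ext tensP (h_linl _ _ _) (h_comb _ _ _ _ _ _)) => a x.
  by rewrite !hE !fE br3 linearPr.
exists (fun t u v => m (t, u) v) => [|a1 a2 a3 x1 x2 x3]; last first.
  by rewrite mE hE fE.
split=> [u v k t t'|t v k u u'|t u]; last exact: m_lin; move: v.
- apply: (tensor_ext tensP (m_lin _) (comb _ _ _ _ _ m_lin)) => c z.
  by rewrite !mE h_linl.
- apply: (tensor_ext tensP (m_lin _) (comb _ _ _ _ _ m_lin)) => c z.
  by rewrite !mE h_lin.
Qed.

End TensorTrilinear.

(** * The grading by the degree of the right factor *)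

Section Concentrated.
Variables (K : fieldType) (A g T : lmodType K).
Variables (tens : {bilinear A -> g -> T}) (tensP : is_tensor_product tens).
Variable (Gg : 'Z_2 -> g -> Prop).

(** The subspace $A\otimes g_i$, the common form of both gradings in the theorem. *)
Definition right_grading (i : 'Z_2) : T -> Prop :=
  lspan (fun t => exists a x, Gg i x /\ t = tens a x).

Lemma tensor_grading_concentrated (GA : 'Z_2 -> A -> Prop) :
    is_grading Gg -> (forall a, GA 0 a) -> (forall a, GA 1 a -> a = 0) ->
  tensor_grading tens GA Gg = right_grading.
Proof.
move=> GgP GA0 GA1; apply: funext => i; apply: funext => t; apply: propext.
split; apply: (lspan_map (@linear_fun_id K T)) => {}t; last first.
  move=> [a [x [Gx ->]]]; apply: lspan_gen.
  by exists 0, i, a, x; rewrite add0r.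
move=> [j [k [a [x [Ga Gx jki ->]]]]]; apply: lspan_gen.
case: (Z2_cases j) Ga jki => [-> _ | -> /GA1 -> _].
  by rewrite add0r => <-; exists a, x.
(* Here the left factor is 0 and [x] need not have degree [i]; the zero tensor is rewritten as
   [tens 0 0], because 0 has every degree. *)
by exists 0, 0; split; [exact: grading0 | rewrite !linear0l].
Qed.

(** Projecting the right factors splits every sum of pure tensors. The sum is direct because [P0],
    the identity tensored with [p 0], fixes degree 0 and kills degree 1. *)
Lemma right_grading_is_grading : is_grading Gg -> is_grading right_grading.
Proof.
move=> GgP; have [p [p_lin pG pD pE]] := grading_proj GgP.
have [||P0 P0E] := tensor_lift tensP (f := fun a x => tens a (p 0 x)).
- by move=> x c a a'; rewrite linearPl.
- by move=> a c x x'; rewrite p_lin linearPr.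
split.
- by move=> i; apply: lspan0.
- by move=> i c v w; apply: lspanP.
- move=> t; elim: (tensor_span tensP t) => [|c v w [a [x ->]] _ IH].
    by exists 0, 0; split; [exact: lspan0 | exact: lspan0 | rewrite addr0].
  have [w0 [w1 [Gw0 Gw1 ->]]] := IH.
  have Gp i : right_grading i (tens a (p i x)).
    by apply: lspan_gen; exists a, (p i x); split; first exact: pG.
  exists (c *: tens a (p 0 x) + w0), (c *: tens a (p 1 x) + w1).
  split; [exact: lspanP (Gp 0) Gw0 | exact: lspanP (Gp 1) Gw1 |].
  by rewrite addrACA -scalerDr -linearDr -pD.
- move=> t G0t G1t; have <- : P0 t = t.
    move: t {G1t} G0t; apply: lspan_linear_eq => //; first exact: linearP.
    by move=> t [a [x [Gx ->]]]; rewrite P0E (pE _ _ _ Gx).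
  move: t {G0t} G1t; apply: (lspan_linear_eq (h := fun=> 0)).
  + exact: linearP.
  + by move=> c u v; rewrite scaler0 addr0.
  + by move=> t [a [x [Gx ->]]]; rewrite P0E (pE _ _ _ Gx) linear0r.
Qed.

End Concentrated.

(** * Verification of the axioms *)

Lemma right_grading_bihom_Lie (K : fieldType) (A g T : lmodType K)
    (tens : {bilinear A -> g -> T}) (GA : 'Z_2 -> A -> Prop)
    (mu : A -> A -> A -> A) (alpha1 beta1 : {linear A -> A})
    (Gg : 'Z_2 -> g -> Prop) (brg : g -> g -> g -> g)
    (alpha2 beta2 : {linear g -> g})
    (br : T -> T -> T -> T) (alpha beta : {linear T -> T}) :
    is_tensor_product tens ->
    is_3totally_bihom_assoc_superalgebra GA mu alpha1 beta1 ->
    is_3bihom_Lie_superalgebra Gg brg alpha2 beta2 ->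
    (forall b, exists a, alpha1 a = b) ->
    (forall a1 a2 a3 : A,
     mu (beta1 a1) (beta1 a2) (alpha1 a3) =
       mu (beta1 a2) (beta1 a1) (alpha1 a3) /\
     mu (beta1 a2) (beta1 a1) (alpha1 a3) =
       mu (beta1 a1) (beta1 a3) (alpha1 a2)) ->
    trilinear br ->
    (forall a1 a2 a3 x1 x2 x3, br (tens a1 x1) (tens a2 x2) (tens a3 x3) =
      tens (mu a1 a2 a3) (brg x1 x2 x3)) ->
    (forall a x, alpha (tens a x) = tens (alpha1 a) (alpha2 x)) ->
    (forall a x, beta (tens a x) = tens (beta1 a) (beta2 x)) ->
  is_3bihom_Lie_superalgebra (right_grading tens Gg) br alpha beta.
Proof.
move=> tensP hA hg surj mu_comm brL brE aE bE.
have map_even (f1 : {linear A -> A}) (f2 : {linear g -> g})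
    (f : {linear T -> T}) :
    even_map Gg f2 -> (forall a x, f (tens a x) = tens (f1 a) (f2 x)) ->
    even_map (right_grading tens Gg) f.
  move=> f2G fE i; apply: lspan_map; first exact: linearP.
  move=> t [a [x [Gx ->]]]; apply: lspan_gen.
  by rewrite fE; exists (f1 a), (f2 x); split; first exact: f2G.
split=> //.
- exact: right_grading_is_grading (bls_grading hg).
- move=> i j k x y z Gx Gy Gz; move: x Gx.
  apply: lspan_map; first by prove_linear.
  move=> _ [a1 [x1 [Gx ->]]]; move: y Gy.
  apply: lspan_map; first by prove_linear.
  move=> _ [a2 [x2 [Gy ->]]]; move: z Gz.
  apply: lspan_map; first by prove_linear.
  move=> _ [a3 [x3 [Gz ->]]]; apply: lspan_gen; rewrite brE.
  exists (mu a1 a2 a3), (brg x1 x2 x3).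
  by split; first exact: bls_even_br hg _ _ _ _ _ _ Gx Gy Gz.
- exact: map_even (bls_even_alpha hg) aE.
- exact: map_even (bls_even_beta hg) bE.
- apply: (tensor_ext tensP); [by prove_linear | by prove_linear |].
  by move=> a x; rewrite !(aE, bE) (tba_comm hA) (bls_comm hg).
- move=> x y z; move: x.
  apply: (tensor_ext tensP); [by prove_linear | by prove_linear |].
  move=> a1 x1; move: y.
  apply: (tensor_ext tensP); [by prove_linear | by prove_linear |].
  move=> a2 x2; move: z.
  apply: (tensor_ext tensP); [by prove_linear | by prove_linear |].
  by move=> a3 x3; rewrite brE !aE brE (tba_alphaM hA) (bls_alphaM hg).
- move=> x y z; move: x.
  apply: (tensor_ext tensP); [by prove_linear | by prove_linear |].
  move=> a1 x1; move: y.
  apply: (tensor_ext tensP); [by prove_linear | by prove_linear |].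
  move=> a2 x2; move: z.
  apply: (tensor_ext tensP); [by prove_linear | by prove_linear |].
  by move=> a3 x3; rewrite brE !bE brE (tba_betaM hA) (bls_betaM hg).
- move=> dx dy dz x y z Gx Gy Gz.
  move: x Gx; apply: lspan_linear_eq; [by prove_linear | by prove_linear |].
  move=> _ [a1 [x1 [Gx ->]]].
  move: y Gy; apply: lspan_linear_eq; [by prove_linear | by prove_linear |].
  move=> _ [a2 [x2 [Gy ->]]].
  move: z Gz; apply: lspan_linear_eq; [by prove_linear | by prove_linear |].
  move=> _ [a3 [x3 [Gz ->]]]; rewrite !(aE, bE) !brE.
  (* The left factors now agree, and the sign comes from [g] alone. *)
  have [-> _] := mu_comm a1 a2 a3.
  by rewrite (bls_skewl hg Gx Gy Gz) linearNr linearZr_LR.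
- move=> dx dy dz x y z Gx Gy Gz.
  move: x Gx; apply: lspan_linear_eq; [by prove_linear | by prove_linear |].
  move=> _ [a1 [x1 [Gx ->]]].
  move: y Gy; apply: lspan_linear_eq; [by prove_linear | by prove_linear |].
  move=> _ [a2 [x2 [Gy ->]]].
  move: z Gz; apply: lspan_linear_eq; [by prove_linear | by prove_linear |].
  move=> _ [a3 [x3 [Gz ->]]]; rewrite !(aE, bE) !brE.
  have [-> ->] := mu_comm a1 a2 a3.
  by rewrite (bls_skewr hg Gx Gy Gz) linearNr linearZr_LR.
- move=> dx dy dz du dv x y z u v Gx Gy Gz Gu Gv.
  move: x Gx; apply: lspan_linear_eq; [by prove_linear | by prove_linear |].
  move=> _ [a1 [x1 [Gx ->]]].
  move: y Gy; apply: lspan_linear_eq; [by prove_linear | by prove_linear |].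
  move=> _ [a2 [x2 [Gy ->]]].
  move: z Gz; apply: lspan_linear_eq; [by prove_linear | by prove_linear |].
  move=> _ [a3 [x3 [Gz ->]]].
  move: u Gu; apply: lspan_linear_eq; [by prove_linear | by prove_linear |].
  move=> _ [a4 [x4 [Gu ->]]].
  move: v Gv; apply: lspan_linear_eq; [by prove_linear | by prove_linear |].
  move=> _ [a5 [x5 [Gv ->]]]; rewrite !(aE, bE) !brE.
  have /= [P1 P2 P3] := mu_perm hA surj mu_comm a1 a2 a3 a4 a5.
  (* All four terms receive the same left factor, so the identity of [g] passes through [tens] by
     linearity in the right factor. *)
  rewrite -P1 -P2 -P3 (bls_jacobi hg Gx Gy Gz Gu Gv).
  by rewrite linearDr linearBr !linearZr_LR.
Qed.

Theorem proposition2p14 (K : fieldType) (A g T : lmodType K)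
  (tens : {bilinear A -> g -> T}) (tensP : is_tensor_product tens)
  (GA : 'Z_2 -> A -> Prop) (mu : A -> A -> A -> A)
  (alpha1 beta1 : {linear A -> A})
  (Gg : 'Z_2 -> g -> Prop) (brg : g -> g -> g -> g)
  (alpha2 beta2 : {linear g -> g})
  (hA : is_3totally_bihom_assoc_superalgebra GA mu alpha1 beta1)
  (hg : is_3bihom_Lie_superalgebra Gg brg alpha2 beta2)
  (alpha1_surj : forall b : A, exists a : A, alpha1 a = b)
  (mu_comm : forall a1 a2 a3 : A,
     mu (beta1 a1) (beta1 a2) (alpha1 a3) =
       mu (beta1 a2) (beta1 a1) (alpha1 a3) /\
     mu (beta1 a2) (beta1 a1) (alpha1 a3) =
       mu (beta1 a1) (beta1 a3) (alpha1 a2)) :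
  exists (br : T -> T -> T -> T) (alpha beta : {linear T -> T}),
    [/\ forall a1 a2 a3 x1 x2 x3,
          br (tens a1 x1) (tens a2 x2) (tens a3 x3) =
          tens (mu a1 a2 a3) (brg x1 x2 x3),
        forall a x, alpha (tens a x) = tens (alpha1 a) (alpha2 x),
        forall a x, beta (tens a x) = tens (beta1 a) (beta2 x),
        is_3bihom_Lie_superalgebra
          (tensor_grading tens (even_grading A) Gg) br alpha beta
      & (forall a, GA 1 a -> a = 0) ->
        is_3bihom_Lie_superalgebra
          (tensor_grading tens GA Gg) br alpha beta].
Proof.
have [alpha aE] := tensor_linear_map tensP alpha1 alpha2.
have [beta bE] := tensor_linear_map tensP beta1 beta2.
have [br brL brE] :=
  tensor_trilinear_map tensP (tba_trilinear hA) (bls_trilinear hg).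
have hT :=
  right_grading_bihom_Lie tensP hA hg alpha1_surj mu_comm brL brE aE bE.
have gP := bls_grading hg.
exists br, alpha, beta; split=> // [|GA1].
  rewrite tensor_grading_concentrated // => a; first by left.
  by case.
rewrite tensor_grading_concentrated // => a.
(* With no nonzero element of degree 1, every [a] equals its degree 0 component. *)
have [a0 [a1 [Ga0 /GA1 -> ->]]] := grading_sum (tba_grading hA) a.
by rewrite addr0.
Qed.
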